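(* Let $k$ be a field, $S=k[x_1,\dots,x_n]$, let $K$ be a simplicial complex with vertex set $V=\{x_1,\dots,x_n\}$, and let $I=I(K)$ be the Stanley–Reisner ideal of $K$. Then $\Delta(S/I)$ is homotopy equivalent to $K$.
   Context: The Stanley–Reisner ideal $I(K)$ is the ideal of $S$ generated by the squarefree monomials $x_{j_1}\cdots x_{j_r}$ such that $\{x_{j_1},\dots,x_{j_r}\}$ is not a face of $K$. $S/I$ is graded with $\mathfrak m$ the ideal of elements of positive degree. For a graded ring $R$ with minimal primes $\mathfrak p_1,\dots,\mathfrak p_m$ and $\mathfrak m$ the ideal of positive-degree elements, $\Delta(R)$ is the simplicial complex on $\{1,\dots,m\}$ in which $\{i_0,\dots,i_s\}$ is a face if and only if $\sqrt{\mathfrak p_{i_0}+\cdots+\mathfrak p_{i_s}}\neq\mathfrak m$. *)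

(* Defs.v *)
From HB Require Import structures.
From mathcomp Require Import all_boot all_order all_algebra.
From mathcomp Require Import mpoly.
From mathcomp Require Import boolp classical_sets reals topology normedtype.
Import GRing.Theory Num.Theory.
Import numFieldNormedType.Exports.

Set Implicit Arguments.
Unset Strict Implicit.
Unset Printing Implicit Defensive.

Local Open Scope ring_scope.
Local Open Scope classical_set_scope.

Section Ideals.
Variable A : comNzRingType.

Definition is_ideal (J : set A) : Prop :=
  J 0 /\ (forall x y, J x -> J y -> J (x + y)) /\ (forall a x, J x -> J (a * x)).

Definition ideal_gen (G : set A) : set A :=
  [set x | exists (r : nat) (a g : 'I_r -> A),
             (forall j, G (g j)) /\ x = \sum_(j < r) a j * g j].

Definition is_prime_ideal (P : set A) : Prop :=
  is_ideal P /\ ~ P 1 /\ (forall x y, P (x * y) -> P x \/ P y).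

Definition minimal_prime_over (I P : set A) : Prop :=
  is_prime_ideal P /\ I `<=` P /\
  (forall Q, is_prime_ideal Q -> I `<=` Q -> Q `<=` P -> Q = P).

Definition radical (J : set A) : set A := [set x | exists k : nat, J (x ^+ k)].

End Ideals.

Definition is_simplicial_complex_on (n : nat) (K : {set {set 'I_n}}) : Prop :=
  (forall F G : {set 'I_n}, F \in K -> G \subset F -> G \in K) /\
  (forall i : 'I_n, [set i]%SET \in K).

Definition var (k : fieldType) (n : nat) (i : 'I_n) : mpoly.mpoly n k :=
  mpoly.mpolyX k (mpoly.mnm1 i).

Definition stanley_reisner (k : fieldType) (n : nat) (K : {set {set 'I_n}})
  : set (mpoly.mpoly n k) :=
  ideal_gen [set p : mpoly.mpoly n k | exists F : {set 'I_n}, F \notin K /\ p = \prod_(i in F) @var k n i].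

Definition irrelevant_ideal (k : fieldType) (n : nat) : set (mpoly.mpoly n k) :=
  [set p | mpoly.mcoeff (mpoly.mnm0 : mpoly.multinom n) p = 0].

(* Delta(S/I), given an enumeration p : 'I_m -> minimal primes (pulled
   back to S).  A face is a nonempty set F of indices with
   sqrt(sum_{i in F} p_i) <> m. *)
Definition Delta_face (k : fieldType) (n m : nat)
  (p : 'I_m -> set (mpoly.mpoly n k)) (F : {set 'I_m}) : Prop :=
  (0 < #|F|)%N /\
  ~ (radical (ideal_gen [set x | exists i, i \in F /\ p i x]) = @irrelevant_ideal k n).

Definition realization (R : realType) (m : nat) (face : {set 'I_m} -> Prop)
  : set 'rV[R]_m :=
  [set x | (forall i, 0 <= x ord0 i) /\ \sum_(i < m) x ord0 i = 1 /\
           face [set i | x ord0 i != 0]%SET].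

Definition homotopic_on (R : realType) (T : topologicalType) (A : set T)
  (f g : T -> T) : Prop :=
  exists H : R * T -> T,
    {within [set t : R | 0 <= t <= 1] `*` A, continuous H} /\
    (forall t x, 0 <= t <= 1 -> A x -> A (H (t, x))) /\
    (forall x, A x -> H (0, x) = f x /\ H (1, x) = g x).

Definition homotopy_equivalent (R : realType) (T U : topologicalType)
  (A : set T) (B : set U) : Prop :=
  exists (f : T -> U) (g : U -> T),
    (forall x, A x -> B (f x)) /\ (forall y, B y -> A (g y)) /\
    {within A, continuous f} /\ {within B, continuous g} /\
    homotopic_on R A (g \o f) id /\ homotopic_on R B (f \o g) id.

(* Main.v *)
(* The minimal primes of S/I(K) are the ideals generated by the variables
   outside a facet of K, and the sum of several of them is generated by the
   variables outside the intersection of their facets. So Delta(S/I) is the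
   nerve of the facets: both complexes are the Dowker complexes of the relation
   "v lies in the facet F_i", one on the vertices, one on the facets.
   Dowker duality is realised without subdivision: send x to the barycentric
   coordinates proportional to max_v x_v - max_(v notin F_i) x_v, and back by
   the transposed formula. The support of x is contained in the support of its
   image under the composite, so the straight-line homotopy stays in the
   complex. *)

Require Import Defs.
From HB Require Import structures.
From mathcomp Require Import all_boot all_order all_algebra.
From mathcomp Require Import mpoly.
From mathcomp Require Import boolp classical_sets reals topology normedtype.
Import numFieldNormedType.Exports.

Set Implicit Arguments.
Unset Strict Implicit.
Unset Printing Implicit Defensive.

Import Order.TTheory GRing.Theory Num.Theory.
Local Open Scope ring_scope.
Local Open Scope classical_set_scope.

(** * Continuity for row vectors *)

Lemma cvg_row (R : realType) (U : Type) (F : set_system U)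
    (FF : Filter F) (n : nat) (f : U -> 'rV[R]_n) (l : 'rV[R]_n) :
  (forall i, (fun x => f x ord0 i) @ F --> l ord0 i) -> f @ F --> l.
Proof.
move=> fl A [P lP PA]; rewrite nbhs_simpl.
have Pf i : F [set x | P ord0 i (f x ord0 i)] by exact: fl.
apply: (@filterS _ F _ _ _ _ (filter_forall FF Pf)) => x Px; apply: PA => j i.
by rewrite ord1; exact: Px.
Qed.

Lemma continuous_bigmax_coord (R : realType) (n : nat) (P : pred 'I_n) :
  continuous (fun x : 'rV[R]_n => \big[Num.max/0]_(v | P v) x ord0 v).
Proof.
apply: continuous_big => [|v _]; first exact: max_continuous.
exact: coord_continuous.
Qed.

(** * Dowker duality for a finite relation *)

Section Dowker.
Variable R : realType.

Definition dowker_face (m n : nat) (rel : 'I_m -> 'I_n -> bool)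
  (F : {set 'I_m}) : Prop := exists i, forall v, v \in F -> rel v i.

(* The length of the interval of levels t < max x for which every v with
   x_v > t is related to i. *)
Definition gap (m n : nat) (rel : 'I_m -> 'I_n -> bool) (x : 'rV[R]_m)
    (i : 'I_n) : R :=
  \big[Num.max/0]_v x ord0 v - \big[Num.max/0]_(v | ~~ rel v i) x ord0 v.

Definition dowker_map (m n : nat) (rel : 'I_m -> 'I_n -> bool)
    (x : 'rV[R]_m) : 'rV[R]_n :=
  \row_i (gap rel x i / \sum_j gap rel x j).

Lemma gap_ge0 (m n : nat) (rel : 'I_m -> 'I_n -> bool) (x : 'rV[R]_m) i :
  0 <= gap rel x i.
Proof. by rewrite subr_ge0; exact: sub_bigmax. Qed.

Lemma gap_le_subr (m n : nat) (rel : 'I_m -> 'I_n -> bool) (x : 'rV[R]_m)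
    v i :
  ~~ rel v i -> gap rel x i <= \big[Num.max/0]_u x ord0 u - x ord0 v.
Proof. by move=> vi; rewrite lerB// le_bigmax_cond. Qed.

(** The coordinates in the subtracted maximum all vanish, which leaves its default value 0. *)
Lemma gap_max (m n : nat) (rel : 'I_m -> 'I_n -> bool) (x : 'rV[R]_m) i :
  (forall v, x ord0 v != 0 -> rel v i) ->
  gap rel x i = \big[Num.max/0]_v x ord0 v.
Proof.
move=> xi; rewrite /gap [X in _ - X]bigmax_eq_id ?subr0// => v.
by apply: contraNle => /gt_eqF/negbT; exact: xi.
Qed.

Lemma continuous_gap (m n : nat) (rel : 'I_m -> 'I_n -> bool) i :
  continuous (fun x => gap rel x i).
Proof.
move=> x; exact: (cvgB (@continuous_bigmax_coord R m (fun=> true) x)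
  (@continuous_bigmax_coord R m (fun v => ~~ rel v i) x)).
Qed.

Section Realization.
Variables (m n : nat) (rel : 'I_m -> 'I_n -> bool) (x : 'rV[R]_m).
Hypothesis xK : realization (dowker_face rel) x.

Lemma bigmax_realization_gt0 : 0 < \big[Num.max/0]_v x ord0 v.
Proof.
case: xK => x0 [x1 _]; rewrite ltNge; apply/negP => /bigmax_leP[_ xle0].
move: x1; rewrite big1 => [/eqP|v _]; first by rewrite eq_sym oner_eq0.
by apply/eqP; rewrite eq_le x0 xle0.
Qed.

Lemma realization_argmax :
  exists v, x ord0 v = \big[Num.max/0]_u x ord0 u.
Proof.
have := bigmax_realization_gt0; case: xK => x0 _ M0.
have [v _|none] := pickP (fun v : 'I_m => true).
  have [u _ ->] := @eq_bigmax _ R _ 0 v predT (fun v => x ord0 v) isT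
    (fun i _ => x0 i).
  by exists u.
(* With no index at all the maximum is the default 0, against its positivity. *)
by move: M0; rewrite big_pred0 ?ltxx.
Qed.

Lemma gap_max_ex :
  exists i, gap rel x i = \big[Num.max/0]_v x ord0 v.
Proof.
case: xK => _ [_ [i xi]]; exists i; apply: gap_max => v v0.
by apply: xi; rewrite inE.
Qed.

Lemma sum_gap_gt0 : 0 < \sum_j gap rel x j.
Proof.
have [i xi] := gap_max_ex.
rewrite (bigD1 i)//= xi ltr_pwDl ?bigmax_realization_gt0//.
by apply: sumr_ge0 => j _; exact: gap_ge0.
Qed.

(** An index [v] of a largest coordinate of [x] witnesses the face: any [i] not related to [v] has
    gap at most [max x - x_v = 0]. *)
Lemma dowker_map_realization :
  realization (dowker_face (fun i v => rel v i)) (dowker_map rel x).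
Proof.
split=> [i|]; first by rewrite mxE divr_ge0 ?gap_ge0 ?ltW ?sum_gap_gt0.
split.
  under eq_bigr do rewrite mxE.
  by rewrite -mulr_suml divff// gt_eqF// sum_gap_gt0.
have [v xv] := realization_argmax; exists v => i; rewrite inE mxE.
apply: contra_neqT => /(gap_le_subr x); rewrite xv subrr => gi.
have -> : gap rel x i = 0 by apply/eqP; rewrite eq_le gi gap_ge0.
by rewrite mul0r.
Qed.

(** The normalising sum is positive at [x], so the quotient is continuous there in the whole ambient
    space, not only within the realization. *)
Lemma continuous_dowker_map : {for x, continuous (@dowker_map m n rel)}.
Proof.
apply: (@cvg_row R _ (nbhs x)) => i.
have -> : (fun y => dowker_map rel y ord0 i) =
    (fun y => gap rel y i * (\sum_j gap rel y j)^-1).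
  by apply/funext => y; rewrite mxE.
have -> : dowker_map rel x ord0 i = gap rel x i * (\sum_j gap rel x j)^-1.
  by rewrite mxE.
have gap_sum : continuous (fun y => \sum_j @gap m n rel y j).
  apply: continuous_big => [|j _]; first exact: add_continuous.
  exact: continuous_gap.
exact: (cvgM (@continuous_gap m n rel i x)
  (cvgV (lt0r_neq0 sum_gap_gt0) (gap_sum x))).
Qed.

End Realization.

(* The indices related to all of supp x maximise the gap, and an index not
   related to v has a strictly smaller gap, since x_v > 0. *)
Lemma supp_dowker_map2 (m n : nat) (rel : 'I_m -> 'I_n -> bool)
    (x : 'rV[R]_m) v :
  realization (dowker_face rel) x -> x ord0 v != 0 ->
  dowker_map (fun i u => rel u i) (dowker_map rel x) ord0 v != 0.
Proof.
move=> xK xv.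
have xv0 : 0 < x ord0 v by rewrite lt_def xv; case: xK => + _; exact.
have [i0 xi0] := gap_max_ex xK.
set y := dowker_map rel x; set M := \big[Num.max/0]_u x ord0 u.
have yi0 : y ord0 i0 = M / \sum_j gap rel x j by rewrite mxE xi0.
have yK := dowker_map_realization xK.
rewrite mxE; apply: mulf_neq0.
  2: by rewrite invr_neq0// gt_eqF//; exact: sum_gap_gt0 yK.
rewrite gt_eqF// subr_gt0; apply: (@lt_le_trans _ _ (y ord0 i0)); last first.
  exact: le_bigmax.
(* [y i0] has to beat the default value 0 of the maximum as well as every [y i] with [i] unrelated
   to [v]. *)
apply/bigmax_ltP; split.
  by rewrite yi0 divr_gt0 ?(sum_gap_gt0 xK) ?(bigmax_realization_gt0 xK).
move=> i vi; rewrite yi0 mxE ltr_pM2r ?invr_gt0 ?(sum_gap_gt0 xK)//.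
by apply: le_lt_trans (gap_le_subr x vi) _; rewrite ltrBlDr ltrDl.
Qed.

Lemma dowker_retraction_homotopic (m n : nat) (rel : 'I_m -> 'I_n -> bool) :
  homotopic_on R (realization (dowker_face rel))
    (dowker_map (fun i v => rel v i) \o dowker_map rel) id.
Proof.
pose g x := dowker_map (fun i v => rel v i) (dowker_map rel x).
have coordE (t : R) (x : 'rV[R]_m) v : ((1 - t) *: g x + t *: x) ord0 v =
    (1 - t) * g x ord0 v + t * x ord0 v.
  by rewrite mxE [X in X + _]mxE [X in _ + X]mxE.
exists (fun z => (1 - z.1) *: g z.2 + z.1 *: z.2); split; last split.
- apply: continuous_in_subspaceT => -[t x]; rewrite inE => -[/= _ xK].
  have gc : {for x, continuous g}.
    exact: (continuous_comp (continuous_dowker_map xK)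
      (continuous_dowker_map (dowker_map_realization xK))).
  apply: (@cvg_row R _ (nbhs (t, x))) => v.
  have -> : (fun z : R * 'rV[R]_m => ((1 - z.1) *: g z.2 + z.1 *: z.2) ord0 v) =
      (fun z => (1 - z.1) * g z.2 ord0 v + z.1 * z.2 ord0 v).
    by apply/funext => z; rewrite coordE.
  rewrite [X in _ --> X]coordE.
  have c1 : (fun z : R * 'rV[R]_m => z.1) @ (t, x) --> t by exact: cvg_fst.
  have c2 : (fun z : R * 'rV[R]_m => z.2) @ (t, x) --> x by exact: cvg_snd.
  have cv := @coord_continuous R 1 m ord0 v.
  have c3 : (fun z : R * 'rV[R]_m => g z.2 ord0 v) @ (t, x) --> g x ord0 v.
    exact: (cvg_comp _ _ (cvg_comp _ _ c2 gc) (cv (g x))).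
  have c4 : (fun z : R * 'rV[R]_m => z.2 ord0 v) @ (t, x) --> x ord0 v.
    exact: (cvg_comp _ _ c2 (cv x)).
  have c5 : (fun z : R * 'rV[R]_m => 1 - z.1) @ (t, x) --> 1 - t.
    by apply: (@cvgB R R^o _ (nbhs (t, x))); [exact: cvg_cst | exact: c1].
  have ff : Filter (nbhs (t, x)) by exact: nbhs_filter.
  exact: (@cvgD R R^o _ (nbhs (t, x)) ff _ _ _ _
    (@cvgM R _ (nbhs (t, x)) ff _ _ _ _ c5 c3)
    (@cvgM R _ (nbhs (t, x)) ff _ _ _ _ c1 c4)).
- move=> t x /andP[t0 t1] xK.
  have [g0 [g1 [i gi]]] := dowker_map_realization (dowker_map_realization xK).
  have [x0 [x1 _]] := xK.
  have t10 : 0 <= 1 - t by rewrite subr_ge0.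
  split => [v|]; first by rewrite coordE addr_ge0// mulr_ge0//; exact: g0.
  split.
    under eq_bigr do rewrite coordE.
    by rewrite big_split/= -!mulr_sumr x1 [X in _ * X + _]g1 !mulr1 subrK.
  (* The witness [i] for the support of [g x] serves the whole segment: where [g x] vanishes, so
     does [x], by [supp_dowker_map2]. *)
  exists i => v; rewrite inE coordE => hv; apply: gi; rewrite inE.
  apply: contra_neq hv => gv.
  have [xv|/(supp_dowker_map2 xK)] := eqVneq (x ord0 v) 0.
  2: by rewrite [dowker_map _ _ _ _]gv eqxx.
  by rewrite [g x ord0 v]gv xv !mulr0 addr0.
- move=> x _ /=.
  by rewrite subr0 scale1r scale0r addr0 subrr scale0r scale1r add0r.
Qed.

Theorem dowker_duality (m n : nat) (rel : 'I_m -> 'I_n -> bool) :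
  homotopy_equivalent R (@realization R _ (dowker_face rel))
    (@realization R _ (dowker_face (fun i v => rel v i))).
Proof.
exists (dowker_map rel), (dowker_map (fun i v => rel v i)).
split=> [x|]; first exact: dowker_map_realization.
split=> [y|]; first exact: dowker_map_realization.
split.
  apply: continuous_in_subspaceT => x; rewrite inE; exact: continuous_dowker_map.
split.
  apply: continuous_in_subspaceT => x; rewrite inE; exact: continuous_dowker_map.
by split; exact: dowker_retraction_homotopic.
Qed.

End Dowker.

(** * Ideals and primes in a commutative ring *)

Section Ideals.
Variable A : comNzRingType.
Implicit Types (J P : set A) (G : set A).

Lemma ideal_sum J (r : nat) (F : 'I_r -> A) :
  is_ideal J -> (forall j, J (F j)) -> J (\sum_(j < r) F j).
Proof. by case=> J0 [JD _] JF; apply: big_ind. Qed.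

Lemma ideal_gen_sub G J : is_ideal J -> G `<=` J -> ideal_gen G `<=` J.
Proof.
move=> idJ GJ x [r [a [g [Gg ->]]]]; apply: ideal_sum => // j.
by case: idJ => _ [_ JM]; apply/JM/GJ.
Qed.

Lemma sub_ideal_gen G : G `<=` ideal_gen G.
Proof.
move=> x Gx; exists 1%N, (fun=> 1), (fun=> x); split=> //.
by rewrite big_ord1 mul1r.
Qed.

Lemma ideal_gen_is_ideal G : is_ideal (ideal_gen G).
Proof.
split; first by exists 0%N, (fun=> 0), (fun=> 0); split=> [[]|]; rewrite ?big_ord0.
split=> [x y|b x].
  move=> [r [a [g [Gg ->]]]] [r' [a' [g' [Gg' ->]]]].
  exists (r + r')%N,
    (fun j => match split j with inl i => a i | inr i => a' i end),
    (fun j => match split j with inl i => g i | inr i => g' i end).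
  split=> [j|]; first by case: (split j).
  rewrite big_split_ord/=; congr (_ + _); apply: eq_bigr => j _.
    by rewrite -[lshift _ j]/(unsplit (inl j)) unsplitK.
  by rewrite -[rshift _ j]/(unsplit (inr j)) unsplitK.
move=> [r [a [g [Gg ->]]]]; exists r, (fun j => b * a j), g; split=> //.
by rewrite mulr_sumr; apply: eq_bigr => j _; rewrite mulrA.
Qed.

Lemma prime_ideal_prod P (I : finType) (s : {set I}) (F : I -> A) :
  is_prime_ideal P -> P (\prod_(i in s) F i) -> exists2 i, i \in s & P (F i).
Proof.
move=> [_ [P1 PM]] Ps; apply: contrapT => none; move: Ps.
apply: (big_ind (fun x => ~ P x)) => // [x y Px Py /PM[]//|i si Pi].
by apply: none; exists i.
Qed.

Lemma prime_ideal_exp P x m : is_prime_ideal P -> P (x ^+ m) -> P x.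
Proof.
move=> [_ [P1 PM]]; elim: m => [|m IHm]; first by rewrite expr0 => /P1.
by rewrite exprS => /PM[].
Qed.

Lemma ideal_prod J (I : finType) (s : {set I}) (F : I -> A) i :
  is_ideal J -> i \in s -> J (F i) -> J (\prod_(i in s) F i).
Proof.
by move=> [_ [_ JM]] si JF; rewrite (bigD1 i)//= mulrC; exact: JM.
Qed.

End Ideals.

(** * Primes generated by variables *)

Section FaceIdeals.
Variables (k : fieldType) (n : nat).
Implicit Types (s t : {set 'I_n}) (q : {mpoly k[n]}) (J : set {mpoly k[n]}).
Local Notation X := (@var k n).

Definition restrict_vars s : {mpoly k[n]} -> {mpoly k[n]} :=
  comp_mpoly [tuple if i \in s then X i else 0 | i < n].

(** This is the ideal generated by the variables outside [s] (see [face_ideal_sub]). As the kernel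
    of a ring morphism into a domain it is visibly prime. *)
Definition face_ideal s : set {mpoly k[n]} := [set q | restrict_vars s q = 0].

Lemma restrict_vars_var s i : restrict_vars s (X i) = if i \in s then X i else 0.
Proof. by rewrite /restrict_vars /var comp_mpolyXU -tnth_nth tnth_mktuple. Qed.

Lemma var_neq0 i : X i != 0.
Proof.
apply/eqP => /(congr1 (mcoeff U_(i))); rewrite /var mcoeffX eqxx mcoeff0.
by move/eqP; rewrite oner_eq0.
Qed.

Lemma face_ideal_var s i : face_ideal s (X i) <-> i \notin s.
Proof.
rewrite /face_ideal/= restrict_vars_var; case: ifP => // _; split=> //.
by move/eqP; rewrite (negbTE (var_neq0 i)).
Qed.

Lemma face_ideal_is_prime s : is_prime_ideal (face_ideal s).
Proof.
rewrite /face_ideal /restrict_vars; split; last split.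
- split=> /=; first exact: rmorph0.
  split=> [x y x0 y0|a x x0] /=; first by rewrite rmorphD/= x0 y0 addr0.
  by rewrite rmorphM/= x0 mulr0.
- by move=> /= /eqP; rewrite rmorph1 oner_eq0.
- move=> x y /= /eqP; rewrite rmorphM/= mulf_eq0.
  by case/orP=> /eqP; [left | right].
Qed.

(** Modulo [J] the substitution fixes each variable, and this property passes to products and linear
    combinations. *)
Lemma sub_restrict_vars J s q : is_ideal J -> (forall i, i \notin s -> J (X i)) ->
  J (q - restrict_vars s q).
Proof.
move=> idJ Js; have [J0 [JD JM]] := idJ; rewrite /restrict_vars.
have mulJ x y : J (x - restrict_vars s x) -> J (y - restrict_vars s y) ->
    J (x * y - restrict_vars s (x * y)).
  move=> Jx Jy; rewrite /restrict_vars rmorphM/=.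
  rewrite -(subrK (x * restrict_vars s y) (x * y)) -mulrBr -addrA -mulrBl.
  by apply: JD; [exact: JM | rewrite mulrC; exact: JM].
have oneJ : J (1 - restrict_vars s 1) by rewrite /restrict_vars rmorph1 subrr.
elim/mpolyind: q => [|c mm q _ _ Jq]; first by rewrite rmorph0 subrr.
rewrite raddfD/= opprD addrACA; apply: JD => //.
rewrite linearZ/= -scalerBr -mul_mpolyC; apply: JM.
rewrite mpolyXE_id; apply: (big_ind (fun x => J (x - restrict_vars s x))) => // i _.
elim: (mm i) => [|e IHe]; rewrite ?expr0// exprS; apply: mulJ => //.
rewrite -/(X i) restrict_vars_var.
by case: ifP => [_|/negbT/Js]; rewrite ?subrr ?subr0.
Qed.

Lemma face_ideal_sub J s : is_ideal J -> (forall i, i \notin s -> J (X i)) ->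
  face_ideal s `<=` J.
Proof.
by move=> idJ Js q sq; have := sub_restrict_vars q idJ Js; rewrite sq subr0.
Qed.

Lemma face_ideal_anti s t : s \subset t -> face_ideal t `<=` face_ideal s.
Proof.
move=> st; apply: face_ideal_sub => [|i it]; first by case: (face_ideal_is_prime s).
by apply/face_ideal_var; apply: contra it; exact: (fintype.subsetP st).
Qed.

Lemma face_ideal0 : face_ideal finset.set0 = @irrelevant_ideal k n.
Proof.
apply/seteqP; split=> [|q q0].
  apply: face_ideal_sub => [|i _]; rewrite /irrelevant_ideal /=; last first.
    rewrite /var mcoeffX; case: eqP => // /(congr1 (fun m : 'X_{1..n} => m i)).
    by rewrite mnm1E eqxx mnm0E.
  split=> /=; first exact: mcoeff0.
  split=> [x y x0 y0|a x x0] /=; first by rewrite mcoeffD x0 y0 addr0.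
  by rewrite rmorphM/= x0 mulr0.
(* Each monomial of [q] is nonconstant, so it contains a variable that is sent to 0. *)
rewrite /face_ideal /restrict_vars/= comp_mpolyEX big1_seq// => mm /andP[_ mmq].
have /eqP/mnmP mm0 : mm != 0%MM.
  by apply: contraTneq mmq => ->; rewrite mcoeff_msupp negbK; exact/eqP.
have [i mmi] : exists i, mm i != 0%N.
  apply: contrapT => none; apply: mm0 => i; rewrite mnm0E; apply: contrapT => mmi.
  by apply: none; exists i; exact/eqP.
rewrite comp_mpolyX (bigD1 i)//= tnth_mktuple inE expr0n (negbTE mmi) mul0r.
by rewrite scaler0.
Qed.

End FaceIdeals.

(** * Minimal primes of the Stanley-Reisner ideal *)

Section StanleyReisner.
Variables (k : fieldType) (n : nat) (K : {set {set 'I_n}}).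
Hypothesis KP : is_simplicial_complex_on K.
Local Notation X := (@var k n).
Local Notation I := (@stanley_reisner k n K).

Definition prime_face (P : set {mpoly k[n]}) : {set 'I_n} :=
  [set v | ~~ `[< P (X v) >]].

Lemma prime_faceP P v : reflect (~ P (X v)) (v \in prime_face P).
Proof. by rewrite inE; apply: (iffP idP) => /asboolPn. Qed.

(** Otherwise the product of these variables would be a generator of [I], and the prime [P] would
    contain one of them. *)
Lemma prime_face_in P : is_prime_ideal P -> I `<=` P -> prime_face P \in K.
Proof.
move=> prP IP; apply: contraT => PK.
have : P (\prod_(i in prime_face P) X i).
  by apply: IP; apply: sub_ideal_gen; exists (prime_face P).
by case/(prime_ideal_prod prP) => i /prime_faceP.
Qed.

(** A nonface is not contained in the face [s], so its monomial involves a variable outside [s]. *)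
Lemma stanley_reisner_sub_face_ideal s : s \in K -> I `<=` face_ideal s.
Proof.
move=> sK; have [ids _] := @face_ideal_is_prime k n s.
apply: ideal_gen_sub => // _ [F [FK ->]].
have /fintype.subsetPn[v vF vs] : ~~ (F \subset s).
  by apply: contra FK; case: KP => + _; apply.
by apply: ideal_prod vF _ => //; exact/face_ideal_var.
Qed.

(** The right-hand side is a prime lying between [I] and [P]. *)
Lemma minimal_primeE P : minimal_prime_over I P -> P = face_ideal (prime_face P).
Proof.
move=> [prP [IP minP]]; apply/esym/minP; first exact: face_ideal_is_prime.
  exact/stanley_reisner_sub_face_ideal/prime_face_in.
apply: face_ideal_sub => [|i]; first by case: prP.
by move/prime_faceP; exact: contrapT.
Qed.

(** A prime [Q] between [I] and [face_ideal s] has a [prime_face] in [K] that contains [s], hence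
    equals [s] by maximality. *)
Lemma facet_minimal_prime s : maxset (mem K) s -> minimal_prime_over I (face_ideal s).
Proof.
case/maxsetP=> sK smax; split; first exact: face_ideal_is_prime.
split; first exact: stanley_reisner_sub_face_ideal.
move=> Q prQ IQ Qs; apply/seteqP; split=> //.
have sQ : s \subset prime_face Q.
  by apply/fintype.subsetP => v vs; apply/prime_faceP => /Qs/face_ideal_var; rewrite vs.
apply: face_ideal_sub => [|v]; first by case: prQ.
rewrite -(smax _ (prime_face_in prQ IQ) sQ).
by move/prime_faceP; exact: contrapT.
Qed.

Lemma prime_face_face_ideal s : prime_face (face_ideal s) = s.
Proof.
apply/setP => v; apply/prime_faceP/idP => [|vs /face_ideal_var/negP//].
by apply: contra_notT => vs; exact/face_ideal_var.
Qed.

Section MinimalPrimes.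
Variables (m : nat) (p : 'I_m -> set {mpoly k[n]}).
Hypothesis p_min : forall i, minimal_prime_over I (p i).

Lemma Delta_faceP (T : {set 'I_m}) :
  Delta_face p T <->
  (0 < #|T|)%N /\ exists v, forall i, i \in T -> v \in prime_face (p i).
Proof.
rewrite /Delta_face; set G := [set x | _].
have pE i := minimal_primeE (p_min i).
split=> -[T0 TP]; split=> //.
  (* With no common vertex, every variable lies in some [p i], so the sum is already the irrelevant
     ideal, which is prime and hence radical. *)
  apply: contrapT => none; apply: TP; rewrite -face_ideal0.
  have prime0 := @face_ideal_is_prime k n finset.set0; apply/seteqP; split.
    move=> x [e xe]; apply: (prime_ideal_exp prime0).
    apply: ideal_gen_sub xe; first by case: prime0.
    by move=> y [i [_]]; rewrite pE; apply: face_ideal_anti; exact: finset.sub0set.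
  move=> x x0; exists 1%N; rewrite expr1.
  apply: face_ideal_sub x0 => [|v _]; first exact: ideal_gen_is_ideal.
  apply: contrapT => Gv; apply: none; exists v => i iT.
  by apply/prime_faceP => piv; apply: Gv; apply: sub_ideal_gen; exists i.
(* Each [p i] with [i] in [T] lies in the prime [face_ideal [set v]], which omits [X v]; so no power
   of [X v] lies in the sum. *)
case: TP => v vT.
have : irrelevant_ideal (X v) by rewrite -face_ideal0; apply/face_ideal_var; rewrite inE.
move=> /[swap] <- [e].
have primev := @face_ideal_is_prime k n [set v]%SET.
move=> ve; suff : face_ideal [set v]%SET (X v) by move/face_ideal_var; rewrite inE eqxx.
apply: (prime_ideal_exp primev); apply: ideal_gen_sub ve; first by case: primev.
move=> y [i [iT]]; rewrite pE; apply: face_ideal_anti.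
by rewrite finset.sub1set; exact: vT.
Qed.

Hypothesis p_all : forall P, minimal_prime_over I P -> exists i, P = p i.

(** Every face extends to a facet, and the prime of that facet is listed by [p]. *)
Lemma mem_complexP (s : {set 'I_n}) :
  s \in K <-> exists i, forall v, v \in s -> v \in prime_face (p i).
Proof.
split=> [sK|[i si]].
  have [t tmax st] := @maxset_exists _ (mem K) s sK.
  have [i pi] := p_all (facet_minimal_prime tmax).
  exists i => v vs; rewrite -pi prime_face_face_ideal; exact: (fintype.subsetP st).
have [prp [Ip _]] := p_min i.
case: KP => + _; apply; first exact: prime_face_in prp Ip.
exact/fintype.subsetP.
Qed.

End MinimalPrimes.
End StanleyReisner.

Theorem theorem3p2 (k : fieldType) (n : nat) (K : {set {set 'I_n}})
  (m : nat) (p : 'I_m -> set (mpoly.mpoly n k)) (R : realType) :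
  is_simplicial_complex_on K ->
  (* p enumerates the minimal primes of S / I(K), without repetition *)
  (forall i, minimal_prime_over (@stanley_reisner k n K) (p i)) ->
  injective p ->
  (forall P, minimal_prime_over (@stanley_reisner k n K) P -> exists i, P = p i) ->
  homotopy_equivalent R
    (@realization R _ (Delta_face p))
    (@realization R _ (fun F => F \in K)).
Proof.
move=> KP p_min _ p_all.
pose rel i v := v \in prime_face (p i).
have -> : @realization R _ (Delta_face p) = realization (dowker_face rel).
  apply/seteqP; split=> x [x0 [x1 xF]]; split=> //; split=> //.
    by have [_] := (Delta_faceP KP p_min _).1 xF.
  apply/(Delta_faceP KP p_min); split=> //.
  (* [Delta_face] demands a nonempty set; the support is nonempty because the coordinates sum to
     1. *)
  rewrite card_gt0; apply: contra_eq_neq x1 => supp0.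
  rewrite big1 => [|i _]; first by rewrite eq_sym oner_neq0.
  by apply/eqP; have /setP/(_ i) := supp0; rewrite !inE => /negbFE.
have -> : @realization R _ (fun F => F \in K) =
    realization (dowker_face (fun v i => rel i v)).
  apply/seteqP; split=> x [x0 [x1 xF]]; split=> //; split=> //.
    exact: (mem_complexP KP p_min p_all _).1 xF.
  exact: (mem_complexP KP p_min p_all _).2 xF.
exact: dowker_duality.
Qed.
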